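(* Let $\mathcal L$ be a logic over team semantics which is local and admits a translation to existential second-order logic $\mathsf{ESO}$. Then every finitely satisfiable set $\Gamma$ of formulas of $\mathcal L$ is satisfiable.
   Context: Teams. For a $\tau$-structure $\mathcal M$ with domain $M$ and a set $D$ of variables (possibly infinite), an assignment of $\mathcal M$ is a map $s\colon D\to M$; a team of $\mathcal M$ with domain $\mathrm{dom}(X)=D$ is a set $X$ of assignments $D\to M$. A logic over team semantics interprets formulas $\phi$ (each with a finite set $\mathrm{Fv}(\phi)$ of free variables) by a relation $\mathcal M\models_X\phi$ between structures $\mathcal M$ with teams $X$, $\mathrm{Fv}(\phi)\subseteq\mathrm{dom}(X)$, and formulas. For $V\subseteq\mathrm{dom}(X)$, $X\upharpoonright V=\{s\upharpoonright V\mid s\in X\}$. For $\vec v=(v_0,\dots,v_{n-1})$ a tuple of variables from $\mathrm{dom}(X)$, $X[\vec v]=\{(s(v_0),\dots,s(v_{n-1}))\mid s\in X\}$. Locality. $\mathcal L$ is local if for every structure $\mathcal M$, team $X$ of $\mathcal M$ and formula $\phi$ of $\mathcal L$: $\mathcal M\models_X\phi$ iff $\mathcal M\models_{X\upharpoonright\mathrm{Fv}(\phi)}\phi$. Translation. $\mathcal L$ admits a translation to $\mathsf{ESO}$ if for every $\tau$-formula $\phi(v_0,\dots,v_{n-1})$ of $\mathcal L$ there is a $\tau\cup\{R\}$-sentence $\chi(R)$ of existential second-order logic, where $R$ is a fresh $n$-ary predicate symbol, such that for all $\tau$-structures $\mathcal M$ and teams $X$ of $\mathcal M$: $\mathcal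 M\models_X\phi(v_0,\dots,v_{n-1})$ iff $(\mathcal M,X[\vec v])\models\chi(R)$ (with $R$ interpreted as $X[\vec v]$). Satisfiability. $\Gamma$ is satisfiable if there are a structure $\mathcal M$ and a nonempty team $X$ of $\mathcal M$ (whose domain contains all free variables of $\Gamma$) with $\mathcal M\models_X\phi$ for all $\phi\in\Gamma$; it is finitely satisfiable if every finite subset of $\Gamma$ is satisfiable. $\Gamma$ may have arbitrarily many free variables. *)

(* Defs.v *)
From mathcomp Require Import all_boot.
From mathcomp Require Import boolp classical_sets functions cardinality.

Set Implicit Arguments.
Unset Strict Implicit.
Unset Printing Implicit Defensive.

Local Open Scope classical_set_scope.

(** * Vocabularies and structures *)

(* Constants are 0-ary function symbols.  There is no bound on the number of
   symbols. *)
Record vocabulary := Vocabulary {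
  rel_sym : Type;
  rel_ar : rel_sym -> nat;
  fun_sym : Type;
  fun_ar : fun_sym -> nat }.

Record structure (tau : vocabulary) := Structure {
  dom :> Type;
  dom_inhabited : inhabited dom;
  rel_int : forall r : rel_sym tau, set ('I_(rel_ar r) -> dom);
  fun_int : forall f : fun_sym tau, ('I_(fun_ar f) -> dom) -> dom }.

(* The fresh symbol is [None]; the symbols of [tau] become [Some _]. *)
Definition add_rel (tau : vocabulary) (n : nat) : vocabulary :=
  {| rel_sym := option (rel_sym tau);
     rel_ar := oapp (@rel_ar tau) n;
     fun_sym := fun_sym tau;
     fun_ar := @fun_ar tau |}.

Definition add_fun (tau : vocabulary) (n : nat) : vocabulary :=
  {| rel_sym := rel_sym tau;
     rel_ar := @rel_ar tau;
     fun_sym := option (fun_sym tau);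
     fun_ar := oapp (@fun_ar tau) n |}.

Definition expand_rel (tau : vocabulary) (M : structure tau) (n : nat)
    (P : set ('I_n -> M)) : structure (add_rel tau n) :=
  @Structure (add_rel tau n) M (dom_inhabited M)
    (fun r => match r return set ('I_(oapp (@rel_ar tau) n r) -> M) with
              | Some r' => @rel_int tau M r'
              | None => P
              end)
    (@fun_int tau M).

Definition expand_fun (tau : vocabulary) (M : structure tau) (n : nat)
    (F : ('I_n -> M) -> M) : structure (add_fun tau n) :=
  @Structure (add_fun tau n) M (dom_inhabited M)
    (@rel_int tau M)
    (fun f => match f return ('I_(oapp (@fun_ar tau) n f) -> M) -> M with
              | Some f' => @fun_int tau M f'
              | None => F
              end).

(** * First-order logic *)

(* Well-scoped de Bruijn syntax: [fo_formula tau k] has its free variables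
   among k indices, and a quantifier binds index 0. *)
Inductive fo_term (tau : vocabulary) (k : nat) : Type :=
| FoVar (i : 'I_k)
| FoApp (f : fun_sym tau) (args : 'I_(fun_ar f) -> fo_term tau k).

Inductive fo_formula (tau : vocabulary) : nat -> Type :=
| FoEq k (t u : fo_term tau k) : fo_formula tau k
| FoRel k (r : rel_sym tau) (args : 'I_(rel_ar r) -> fo_term tau k) :
    fo_formula tau k
| FoNot k (a : fo_formula tau k) : fo_formula tau k
| FoAnd k (a b : fo_formula tau k) : fo_formula tau k
| FoOr k (a b : fo_formula tau k) : fo_formula tau k
| FoEx k (a : fo_formula tau k.+1) : fo_formula tau k
| FoAll k (a : fo_formula tau k.+1) : fo_formula tau k.

Definition fo_sentence (tau : vocabulary) : Type := fo_formula tau 0.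

Definition env_cons (A : Type) (k : nat) (x : A) (e : 'I_k -> A) :
    'I_k.+1 -> A :=
  fun i => oapp e x (unlift ord0 i).

Fixpoint term_val (tau : vocabulary) (M : structure tau) (k : nat)
    (e : 'I_k -> M) (t : fo_term tau k) : M :=
  match t with
  | FoVar i => e i
  | FoApp f args => fun_int (fun i => term_val e (args i))
  end.

Fixpoint fo_sat (tau : vocabulary) (M : structure tau) (k : nat)
    (a : fo_formula tau k) : ('I_k -> M) -> Prop :=
  match a in fo_formula _ k return ('I_k -> M) -> Prop with
  | FoEq _ t u => fun e => term_val e t = term_val e u
  | FoRel _ r args => fun e => rel_int (fun i => term_val e (args i))
  | FoNot _ a => fun e => ~ fo_sat a e
  | FoAnd _ a b => fun e => fo_sat a e /\ fo_sat b e
  | FoOr _ a b => fun e => fo_sat a e \/ fo_sat b e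
  | FoEx _ a => fun e => exists x : M, fo_sat a (env_cons x e)
  | FoAll _ a => fun e => forall x : M, fo_sat a (env_cons x e)
  end.

Definition fo_models (tau : vocabulary) (M : structure tau)
    (a : fo_sentence tau) : Prop :=
  forall e : 'I_0 -> M, fo_sat a e.

(** * Existential second-order logic *)

(* A finite block of existential quantifiers over relations and functions,
   followed by a first-order sentence over the extended vocabulary. *)
Inductive eso_sentence (tau : vocabulary) : Type :=
| EsoFo (a : fo_sentence tau)
| EsoExRel (n : nat) (c : eso_sentence (add_rel tau n))
| EsoExFun (n : nat) (c : eso_sentence (add_fun tau n)).

Fixpoint eso_models (tau : vocabulary) (M : structure tau)
    (c : eso_sentence tau) : Prop :=
  match c with
  | EsoFo a => fo_models M a
  | EsoExRel n c =>
      exists P : set ('I_n -> M), eso_models (expand_rel P) c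
  | EsoExFun n c =>
      exists F : ('I_n -> M) -> M, eso_models (expand_fun F) c
  end.

(** * Teams *)

(* [V] is the type of variables; [D] is coerced to the type of its elements. *)
Definition team (V A : Type) (D : set V) : Type := set (D -> A).

Definition set_widen (V : Type) (D E : set V) (DE : D `<=` E) (x : D) : E :=
  exist _ (val x) (mem_set (DE _ (set_mem (valP x)))).

Definition team_restrict (V A : Type) (D E : set V) (X : team A E)
    (DE : D `<=` E) : team A D :=
  [set s \o set_widen DE | s in X].

Definition team_rel (V A : Type) (D : set V) (X : team A D) (n : nat)
    (v : 'I_n -> D) : set ('I_n -> A) :=
  [set s \o v | s in X].

(** * Logics over team semantics *)

(* [team_sat] is only meaningful when the domain of the team contains the free
   variables of the formula; everything below uses it under that condition. *)
Record team_logic (V : Type) := TeamLogic {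
  formula : vocabulary -> Type;
  free_vars : forall tau : vocabulary, formula tau -> set V;
  free_vars_finite : forall (tau : vocabulary) (phi : formula tau),
    finite_set (free_vars phi);
  team_sat : forall (tau : vocabulary) (M : structure tau) (D : set V),
    team M D -> formula tau -> Prop }.

Arguments free_vars {V} L {tau} phi : rename.
Arguments team_sat {V} L {tau} M {D} X phi : rename.

Definition is_local (V : Type) (L : team_logic V) : Prop :=
  forall (tau : vocabulary) (M : structure tau) (D : set V) (X : team M D)
    (phi : formula L tau) (FD : free_vars L phi `<=` D),
  team_sat L M X phi <-> team_sat L M (team_restrict X FD) phi.

(* [v] lists the free variables of [phi] without repetition. *)
Definition admits_eso_translation (V : Type) (L : team_logic V) : Prop :=
  forall (tau : vocabulary) (phi : formula L tau) (n : nat)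
    (v : 'I_n -> free_vars L phi), bijective v ->
  exists chi : eso_sentence (add_rel tau n),
  forall (M : structure tau) (D : set V) (X : team M D)
    (FD : free_vars L phi `<=` D),
  team_sat L M X phi <->
  eso_models (expand_rel (team_rel X (set_widen FD \o v))) chi.

Definition satisfiable (V : Type) (L : team_logic V) (tau : vocabulary)
    (Gamma : set (formula L tau)) : Prop :=
  exists (M : structure tau) (D : set V) (X : team M D),
  [/\ X !=set0,
      forall phi, Gamma phi -> free_vars L phi `<=` D &
      forall phi, Gamma phi -> team_sat L M X phi].

Definition finitely_satisfiable (V : Type) (L : team_logic V)
    (tau : vocabulary) (Gamma : set (formula L tau)) : Prop :=
  forall Delta : set (formula L tau),
  Delta `<=` Gamma -> finite_set Delta -> satisfiable Delta.

(* Main.v *)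
Require Import Defs.
From mathcomp Require Import all_boot.
From mathcomp Require Import boolp classical_sets functions cardinality.
From mathcomp Require Import filter.

(** A model of [Gamma] is obtained as an ultraproduct indexed by the finite
    subsets of [Gamma].  Locality lets one extend the team witnessing the
    satisfiability of a finite [Delta] to all variables (allowing all values
    outside its domain), so every [Delta] comes with a structure
    [M Delta] and a nonempty team [Y Delta] of total assignments
    ([satisfiable_full]).  Take an ultrafilter containing, for each [phi] in
    [Gamma], the set of those [Delta] that contain [phi]; then each [phi] of
    [Gamma] holds in [M Delta] with [Y Delta] for almost every [Delta].

    The remaining difficulty is to find one team in the ultraproduct whose
    relations on the free variables of all the [phi] are simultaneously the
    right ones.  Treating the relations [Y Delta [v]] as predicates and applying
    compactness formula by formula leaves them to be glued into a team, which
    would need saturation.  The internal team [ultra_team], made of the classes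
    of families of assignments picked coordinatewise from the [Y Delta], avoids
    this: for every finite tuple [v], its relation on [v] is exactly the
    ultraproduct of the relations of the [Y Delta] on [v]
    ([team_rel_ultra_team]).  Hence the structure in which the translation of
    [phi] has to be evaluated is itself an ultraproduct of structures almost all
    of which satisfy this translation, and ESO sentences pass to ultraproducts:
    choose witnesses for the second-order quantifiers coordinatewise, then
    apply the theorem of Los ([eso_models_ultraproduct]). *)

Set Implicit Arguments.
Unset Strict Implicit.
Unset Printing Implicit Defensive.

Local Open Scope classical_set_scope.
Local Open Scope quotient_scope.

(** * The carrier of an ultraproduct *)

Lemma dfunctional_choice (I : Type) (A : I -> Type) (P : forall i, A i -> Prop) :
  (forall i, exists x, P i x) -> exists f : forall i, A i, forall i, P i (f i).
Proof. by move=> /(_ _)/cid-/all_sig[f fP]; exists f. Qed.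

Section Carrier.
Variables (I : Type) (U : set_system I) (UU : UltraFilter U).
Variable A : I -> Type.

Definition near_eq (f g : {classic (forall i, A i)}) : bool :=
  `[< \forall i \near U, f i = g i >].

Lemma near_eq_refl : reflexive near_eq.
Proof. by move=> f; apply/asboolP; apply: nearW. Qed.

Lemma near_eq_sym : symmetric near_eq.
Proof. by move=> f g; apply: asbool_equiv_eq; split; apply: filterS. Qed.

Lemma near_eq_trans : transitive near_eq.
Proof.
move=> g f h /asboolP fg /asboolP gh; apply/asboolP.
by apply: filterS2 fg gh => i -> ->.
Qed.

Definition near_eq_equiv :=
  EquivRel near_eq near_eq_refl near_eq_sym near_eq_trans.

(** The carrier depends on the sets [A i] alone, so that taking ultraproducts
    and expanding by a new symbol commute up to equality of structures and not
    merely up to isomorphism. *)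
Definition ultra : Type := {eq_quot near_eq_equiv}.

Definition uclass (f : forall i, A i) : ultra := \pi_({eq_quot near_eq_equiv}) f.
Definition urepr (x : ultra) : forall i, A i := repr (x : {eq_quot near_eq_equiv}).

Lemma ureprK x : uclass (urepr x) = x.
Proof. exact: reprK. Qed.

Lemma uclassP f g : uclass f = uclass g <-> \forall i \near U, f i = g i.
Proof.
by split=> [/eqmodP/asboolP //|fg]; apply/eqmodP/asboolP.
Qed.

Lemma near_urepr f : \forall i \near U, urepr (uclass f) i = f i.
Proof. by apply/uclassP; rewrite ureprK. Qed.

(** This is where finiteness of arities enters: only finitely many sets of the
    filter are intersected, so the chosen representatives of a whole tuple are
    correct at almost every index simultaneously. *)
Lemma near_urepr_tuple n (e : 'I_n -> forall i, A i) :
  \forall i \near U,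
    (fun j => urepr (uclass (e j)) i) = (fun j => e j i).
Proof.
have : \forall i \near U, forall j, urepr (uclass (e j)) i = e j i.
  by apply: filter_forall => j; exact: near_urepr.
by apply: filterS => i ij; apply: funext.
Qed.

End Carrier.

Arguments uclass {I U} UU {A} f.

(** * Logical connectives along an ultrafilter *)

Section Ultraproduct.
Variables (I : Type) (U : set_system I) (UU : UltraFilter U).

Lemma near_not (P : I -> Prop) :
  (\forall i \near U, ~ P i) <-> ~ (\forall i \near U, P i).
Proof.
split=> [nP P_|nP].
  by have /filter_ex[i []] : \forall i \near U, P i /\ ~ P i by apply: filterI.
by case: (in_ultra_setVsetC [set i | P i] UU).
Qed.

Lemma near_or (P Q : I -> Prop) :
  (\forall i \near U, P i \/ Q i) <->
  (\forall i \near U, P i) \/ (\forall i \near U, Q i).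
Proof.
split=> [PQ|[] ]; last 2 first.
- by apply: filterS; left.
- by apply: filterS; right.
have [P_|nP] := pselect (\forall i \near U, P i); first by left.
by right; move/near_not: nP => nP; apply: filterS2 PQ nP => i [].
Qed.

(** Indices at which no witness exists are filled with an arbitrary element;
    this is why the [A i] must all be inhabited. *)
Lemma near_exists (A : I -> Type) (P : forall i, A i -> Prop) :
  (forall i, inhabited (A i)) ->
  (\forall i \near U, exists x, P i x) <->
  exists f : forall i, A i, \forall i \near U, P i (f i).
Proof.
move=> A0; split=> [exP|[f]]; last by apply: filterS => i; exists (f i).
have /dfunctional_choice[f fP] : forall i, exists x, (exists y, P i y) -> P i x.
  move=> i; have [[x Px]|nP] := pselect (exists y, P i y); first by exists x.
  by have [x] := A0 i; exists x => /nP.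
by exists f; apply: filterS exP => i /fP.
Qed.

(** * Ultraproducts of structures *)

Definition ultra_rel (A : I -> Type) n (P : forall i, set ('I_n -> A i)) :
    set ('I_n -> ultra UU A) :=
  [set a | \forall i \near U, P i (fun j => urepr (a j) i)].

Definition ultra_fun (A : I -> Type) n (F : forall i, ('I_n -> A i) -> A i)
    (a : 'I_n -> ultra UU A) : ultra UU A :=
  uclass UU (fun i => F i (fun j => urepr (a j) i)).

Lemma ultra_relE (A : I -> Type) n (P : forall i, set ('I_n -> A i))
    (e : 'I_n -> forall i, A i) :
  ultra_rel P (fun j => uclass UU (e j)) <->
  \forall i \near U, P i (fun j => e j i).
Proof.
have E := near_urepr_tuple UU e.
by split; apply: filterS2 E => i ->.
Qed.

Lemma ultra_funE (A : I -> Type) n (F : forall i, ('I_n -> A i) -> A i)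
    (e : 'I_n -> forall i, A i) :
  ultra_fun F (fun j => uclass UU (e j)) =
  uclass UU (fun i => F i (fun j => e j i)).
Proof.
by apply/uclassP; have := near_urepr_tuple UU e; apply: filterS => i ->.
Qed.

Lemma ultra_inhabited (A : I -> Type) :
  (forall i, inhabited (A i)) -> inhabited (ultra UU A).
Proof.
move=> A0; have /dfunctional_choice[f _] : forall i, exists x : A i, True.
  by move=> i; have [x] := A0 i; exists x.
exact: (inhabits (uclass UU f)).
Qed.

Definition ultraproduct (tau : vocabulary) (M : I -> structure tau) :
    structure tau :=
  @Structure tau (ultra UU (fun i => dom (M i)))
    (ultra_inhabited (fun i => dom_inhabited (M i)))
    (fun r => ultra_rel (fun i => @rel_int tau (M i) r))
    (fun f => ultra_fun (fun i => @fun_int tau (M i) f)).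

(** The two sides have the same carrier and the same functions by computation;
    only the interpretations of the relation symbols need a case distinction
    between the new symbol and the old ones. *)
Lemma ultraproduct_expand_rel (tau : vocabulary) (M : I -> structure tau) n
    (P : forall i, set ('I_n -> M i)) :
  ultraproduct (fun i => expand_rel (P i)) =
  expand_rel (M := ultraproduct M) (ultra_rel P).
Proof.
rewrite /ultraproduct /expand_rel /=.
by congr (@Structure (add_rel tau n)); apply: functional_extensionality_dep => -[].
Qed.

Lemma ultraproduct_expand_fun (tau : vocabulary) (M : I -> structure tau) n
    (F : forall i, ('I_n -> M i) -> M i) :
  ultraproduct (fun i => expand_fun (F i)) =
  expand_fun (M := ultraproduct M) (ultra_fun F).
Proof.
rewrite /ultraproduct /expand_fun /=.
by congr (@Structure (add_fun tau n)); apply: functional_extensionality_dep => -[].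
Qed.

Lemma term_val_ultraproduct (tau : vocabulary) (M : I -> structure tau) k
    (e : 'I_k -> forall i, M i) (t : fo_term tau k) :
  @term_val tau (ultraproduct M) k (fun j => uclass UU (e j)) t =
  uclass UU (fun i => term_val (fun j => e j i) t).
Proof.
elim: t => [//|f args IH] /=.
by rewrite (funext IH) ultra_funE.
Qed.

Lemma env_cons_comp (A B : Type) (h : A -> B) k (x : A) (e : 'I_k -> A) :
  env_cons (h x) (h \o e) = h \o env_cons x e.
Proof. by apply: funext => j; rewrite /env_cons /=; case: unlift. Qed.

(** Theorem of Los.  The environment is given by representatives, because the
    quantifier cases need witnesses as families [f], which are then consed onto
    the environment coordinatewise.  Maximality of [U] enters through negation
    and disjunction; a universal quantifier is treated as the negation of an
    existential one. *)
Lemma los (tau : vocabulary) (M : I -> structure tau) k (a : fo_formula tau k)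
    (e : 'I_k -> forall i, M i) :
  @fo_sat tau (ultraproduct M) k a (fun j => uclass UU (e j)) <->
  \forall i \near U, fo_sat a (fun j => e j i).
Proof.
(* Both quantifiers reduce to instances at classes of families [f]. *)
have exE l (b : fo_formula tau l.+1) (d : 'I_l -> forall i, M i) :
    (forall d', @fo_sat tau (ultraproduct M) l.+1 b (fun j => uclass UU (d' j)) <->
      \forall i \near U, fo_sat b (fun j => d' j i)) ->
    forall f, @fo_sat tau (ultraproduct M) l.+1 b
        (env_cons (uclass UU f) (fun j => uclass UU (d j))) <->
      \forall i \near U, fo_sat b (env_cons (f i) (fun j => d j i)).
  move=> IH f; rewrite env_cons_comp IH.
  have E i : (fun j => env_cons f d j i) = env_cons (f i) (fun j => d j i).
    exact: esym (env_cons_comp (fun g : forall i, M i => g i) f d).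
  by split; apply: filterS => i; rewrite E.
elim: a e => {k} [k t u|k r args|k a IH|k a IHa b IHb|k a IHa b IHb|k a IH|k a IH] e /=.
- by rewrite !term_val_ultraproduct uclassP.
- by rewrite (funext (fun j => term_val_ultraproduct e (args j))) ultra_relE.
- by rewrite IH near_not.
- by rewrite IHa IHb near_andP.
- by rewrite IHa IHb near_or.
- rewrite near_exists; last by move=> i; exact: dom_inhabited.
  split=> [[x]|[f]]; last by rewrite -exE //; exists (uclass UU f).
  by rewrite -(ureprK x) exE // => ?; exists (urepr x).
- split=> [all|all x]; last first.
    by rewrite -(ureprK x) exE //; apply: filterS all => i.
  (* If almost all coordinates had a counterexample, choosing them
     coordinatewise would give a counterexample in the ultraproduct. *)
  apply: contrapT => /near_not.
  under eq_near do rewrite -existsNE.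
  rewrite near_exists; last by move=> i; exact: dom_inhabited.
  by move=> [f /near_not]; apply; rewrite -exE.
Qed.

(** Only this implication holds for ESO: an arbitrary relation on the
    ultraproduct witnessing a second-order quantifier need not come from
    relations on the factors. *)
Lemma eso_models_ultraproduct (tau : vocabulary) (c : eso_sentence tau)
    (M : I -> structure tau) :
  (\forall i \near U, eso_models (M i) c) -> eso_models (ultraproduct M) c.
Proof.
elim: c M => {tau} [tau a|tau n c IH|tau n c IH] M /=.
- move=> Ma e.
  rewrite (_ : e = fun j => uclass UU (urepr (e j))).
    by rewrite los; apply: filterS Ma => i; exact.
  by apply: funext => j; rewrite ureprK.
- rewrite near_exists => [[P MP]|i]; last by split; exact: set0.
  by exists (ultra_rel P); rewrite -ultraproduct_expand_rel; apply: IH.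
- rewrite near_exists => [[F MF]|i]; last first.
    by have [x] := dom_inhabited (M i); split; exact: (fun=> x).
  by exists (ultra_fun F); rewrite -ultraproduct_expand_fun; apply: IH.
Qed.

(** * The internal team *)

Definition ultra_team (V : Type) (D : set V) (A : I -> Type)
    (Y : forall i, team (A i) D) : team (ultra UU A) D :=
  [set s | exists2 t : D -> forall i, A i,
     forall i, Y i (fun x => t x i) & s = uclass UU \o t].

(** If a tuple of classes lies in the relation of [Y i] on [v] for almost every
    [i], then assignments of [Y i] realizing it can be chosen at these [i];
    completing them by any members of the remaining [Y i] (nonempty by
    hypothesis) does not change the classes of the values. *)
Lemma team_rel_ultra_team (V : Type) (D : set V) (A : I -> Type)
    (Y : forall i, team (A i) D) n (v : 'I_n -> D) :
  (forall i, Y i !=set0) ->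
  team_rel (ultra_team Y) v = ultra_rel (fun i => team_rel (Y i) v).
Proof.
move=> Y0; apply/seteqP; split=> [_ [_ [t Yt ->] <-]|a].
  by rewrite (ultra_relE _ (t \o v)); apply: nearW => i; exists (fun x => t x i).
rewrite /ultra_rel /team_rel /= => Ya.
have /dfunctional_choice[t tP] : forall i, exists t, Y i t /\
    ((exists2 s, Y i s & s \o v = fun j => urepr (a j) i) ->
     t \o v = fun j => urepr (a j) i).
  move=> i; have [[s Ys sv]|nY] := pselect (exists2 s, Y i s &
    s \o v = fun j => urepr (a j) i); first by exists s.
  by have [s Ys] := Y0 i; exists s; split => // /nY.
exists (uclass UU \o (fun x i => t i x)).
  by exists (fun x i => t i x) => // i; have [] := tP i.
apply: funext => j /=; rewrite -[RHS]ureprK; apply/uclassP.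
by apply: filterS Ya => i /(tP i).2/(congr1 (@^~ j)).
Qed.

End Ultraproduct.

Arguments ultra_team {I U} UU {V D A} Y.

(** * Teams of total assignments *)

(** All total extensions of the assignments of [X]. *)
Definition full_team (V A : Type) (D : set V) (X : team A D) : team A [set: V] :=
  [set s : [set: V] -> A | X (s \o set_widen (@subsetT _ D))].

Lemma full_teamK (V A : Type) (D : set V) (X : team A D) : inhabited A ->
  team_restrict (full_team X) (@subsetT _ D) = X.
Proof.
move=> [a]; apply/seteqP; split=> [_ [s Xs <-] //|s Xs].
pose t (x : [set: V]) : A :=
  if pselect (D (val x)) is left Dx then s (exist _ (val x) (mem_set Dx)) else a.
suff ts : t \o set_widen (@subsetT _ D) = s by exists t; rewrite // /full_team /= ts.
apply: funext => -[x Dx]; rewrite /t /=.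
by case: pselect => [Dx'|/(_ (set_mem Dx)) //]; congr s; exact: val_inj.
Qed.

Lemma team_restrict_comp (V A : Type) (D E F : set V) (X : team A F)
    (DE : D `<=` E) (EF : E `<=` F) (DF : D `<=` F) :
  team_restrict (team_restrict X EF) DE = team_restrict X DF.
Proof.
have widenE s : (s \o set_widen EF) \o set_widen DE = s \o set_widen DF.
  by apply: funext => x /=; congr s; exact: val_inj.
apply/seteqP; split=> [_ [_ [s Xs <-] <-]|_ [s Xs <-]].
  by exists s; rewrite // widenE.
by exists (s \o set_widen EF); [exists s|exact: widenE].
Qed.

(** With total assignments all the structures of a family of satisfying teams
    share one domain of variables, so that their ultraproduct makes sense.
    Widening is harmless because, by locality, both teams can be compared on the
    free variables of each formula, where they agree. *)
Lemma satisfiable_full (V : Type) (L : team_logic V) (tau : vocabulary)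
    (Gamma : set (formula L tau)) : is_local L -> satisfiable Gamma ->
  exists (M : structure tau) (Y : team M [set: V]),
    Y !=set0 /\ forall phi, Gamma phi -> team_sat L M Y phi.
Proof.
move=> locL [M [D [X [[s Xs] FD satX]]]].
have Y_X := full_teamK X (dom_inhabited M).
exists M, (full_team X); split.
  by move: Xs; rewrite -[X in X s -> _]Y_X => -[t Yt _]; exists t.
move=> phi Gphi.
rewrite (locL _ _ _ _ _ (@subsetT _ _)).
rewrite -(team_restrict_comp _ (FD _ Gphi) (@subsetT _ D)) Y_X -locL.
exact: satX.
Qed.

(** * Transfer to the ultraproduct and conclusion *)

Lemma finite_set_enum (T : Type) (A : set T) :
  finite_set A -> exists n (v : 'I_n -> A), bijective v.
Proof.
move=> [n]; rewrite card_eq_sym => /card_bijP[f f_bij].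
exists n, (f \o ordII); apply: bij_comp f_bij _.
by exists IIord; [exact: ordIIK|exact: IIordK].
Qed.

(** The theorem of Los for team satisfaction, from left to right: the
    translation turns it into a statement about the structures expanded by the
    relations of the teams, and the ultraproduct of these expansions is the
    expansion of the ultraproduct by the relation of the internal team. *)
Lemma ultra_team_sat (V : Type) (L : team_logic V) (tau : vocabulary)
    (I : Type) (U : set_system I) (UU : UltraFilter U) (M : I -> structure tau)
    (D : set V) (Y : forall i, team (M i) D) (phi : formula L tau) :
  admits_eso_translation L -> free_vars L phi `<=` D ->
  (forall i, Y i !=set0) ->
  (\forall i \near U, team_sat L (M i) (Y i) phi) ->
  team_sat L (ultraproduct UU M) (ultra_team UU Y) phi.
Proof.
move=> trL FD Y0 satY.
have [n [v v_bij]] := finite_set_enum (free_vars_finite phi).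
have [chi chiP] := trL _ phi n v v_bij.
rewrite (chiP _ _ _ FD) team_rel_ultra_team // -ultraproduct_expand_rel.
apply: eso_models_ultraproduct.
by apply: filterS satY => i; rewrite (chiP _ _ _ FD).
Qed.

(** The finite subsets of [G] that contain both [D] and [E] are those that
    contain the finite set [D `|` E], so these up-sets generate a proper filter, which
    extends to an ultrafilter. *)
Lemma finite_subsets_ultrafilter (T : Type) (G : set T) :
  exists2 U : set_system {D : set T | D `<=` G /\ finite_set D},
    UltraFilter U & forall x, G x -> \forall D \near U, sval D x.
Proof.
pose I := {D : set T | D `<=` G /\ finite_set D}.
pose B (D : I) : set I := [set E | sval D `<=` sval E].
have I0 : set0 `<=` G /\ finite_set (@set0 T) by split.
have BF : Filter (filter_from setT B).
  apply: filter_fromT_filter; first by exists (exist _ set0 I0 : I).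
  move=> [D [DG Df]] [E [EG Ef]].
  have DE : D `|` E `<=` G /\ finite_set (D `|` E).
    by rewrite subUset finite_setU.
  by exists (exist _ (D `|` E) DE : I) => F /=; rewrite /B /= subUset.
have [|U [UU BU]] := @ultraFilterLemma _ (filter_from setT B).
  by apply: filter_from_proper => // D _; exists D => x.
exists U => // x Gx; apply: BU.
have x1 : [set x] `<=` G /\ finite_set [set x] by split=> // _ ->.
by exists (exist _ [set x] x1 : I) => // D /(_ x erefl).
Qed.

Theorem theorem4p5 (V : Type) (L : team_logic V) :
  is_local L -> admits_eso_translation L ->
  forall (tau : vocabulary) (Gamma : set (formula L tau)),
  finitely_satisfiable Gamma -> satisfiable Gamma.
Proof.
move=> locL trL tau Gamma finsat.
have [U UU UG] := finite_subsets_ultrafilter Gamma.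
pose I := {D : set (formula L tau) | D `<=` Gamma /\ finite_set D}.
have /choice[MY MYP] : forall i : I, exists MY : {M : structure tau & team M [set: V]},
    projT2 MY !=set0 /\
    forall phi, sval i phi -> team_sat L (projT1 MY) (projT2 MY) phi.
  move=> [D [DG Df]].
  have [M [Y MYP]] := satisfiable_full locL (finsat D DG Df).
  by exists (existT _ M Y).
pose Y i := projT2 (MY i).
have Y0 i : Y i !=set0 by have [] := MYP i.
exists (ultraproduct UU (fun i => projT1 (MY i))), [set: V], (ultra_team UU Y).
split=> [|phi _|phi Gphi].
- have /dfunctional_choice[t Yt] : forall i, exists t, Y i t by [].
  by exists (uclass UU \o fun x i => t i x); exists (fun x i => t i x).
- exact: subsetT.
- apply: ultra_team_sat => //.
  by apply: filterS (UG _ Gphi) => i; have [_] := MYP i; exact.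
Qed.
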